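(* The systems $(\Sigma_N^{\mathbb{Z}},\Pi_{p,N})$ and $(\Sigma_N^{\mathbb{Z}},\Pi_{1/p,N})$ are regular for any $p,N\in\mathbb{Z}_+$ such that these maps are defined.
   Context: $\Sigma_N=\{0,\dots,N-1\}$; $\Sigma_N^{\mathbb{Z}}$ has the prodiscrete topology. **Multiplication automata.** For $p$ dividing $N$ with $N=pq$, $\Pi_{p,N}:\Sigma_N^{\mathbb{Z}}\to\Sigma_N^{\mathbb{Z}}$ is $\Pi_{p,N}(x)[i]=g_{p,N}(x[i],x[i+1])$, where $g_{p,N}(a_1q+a_0,b_1q+b_0)=a_0p+b_1$ for $a_0,b_0\in\Sigma_q$, $a_1,b_1\in\Sigma_p$. These maps are bijective and commute. If $\alpha=p/q$ with $p=\prod p_i$, $q=\prod q_j$ products of positive divisors $p_i,q_j$ of $N$, then $\Pi_{\alpha,N}$ is the composition of the maps $\Pi_{p_i,N}$ and $\Pi_{q_j,N}^{-1}$ (independent of the decomposition). $\Pi_{\alpha,N}$ is ''defined'' exactly for such $\alpha$; in particular $\Pi_{p,N}$ can be defined also for $p$ not dividing $N$ (e.g. $p$ a power of a divisor of $N$). **Regularity.** A dynamical system $(X,T)$ is a compact metrizable space with a continuous self-map; $(Y,S)$ is a factor of $(X,T)$ if there is a continuous surjection $\psi:X\to Y$ with $\psi\circ T=S\circ\psi$. A one-sided subshift is a system $(Y,\sigma)$ with $Y\subseteq\Sigma^{\mathbb{N}}$ closed ($\Sigma$ a finite alphabet), $\sigma(Y)\subseteq Y$, where $\sigma(x)[i]=x[i+1]$.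 A subshift is sofic if it is a factor of a subshift of finite type. A dynamical system $(X,T)$ with $X$ a zero-dimensional compact metrizable space is called regular if all its one-sided subshift factors are sofic. *)

(* Defs.v *)
From HB Require Import structures.
From mathcomp Require Import all_boot all_order all_algebra.
From mathcomp Require Import all_classical all_reals topology.
Set Implicit Arguments.
Unset Strict Implicit.
Unset Printing Implicit Defensive.
Import Order.TTheory GRing.Theory Num.Theory.
Local Open Scope classical_set_scope.
Local Open Scope ring_scope.

(** * Dynamical systems *)

(* All realTypes are isomorphic, so the choice of [R] is immaterial. *)
Definition metrizable (R : realType) (X : topologicalType) : Prop :=
  exists d : X -> X -> R,
    [/\ forall x y, 0 <= d x y,
        forall x y, d x y = 0 <-> x = y,
        forall x y, d x y = d y x,
        forall x y z, d x z <= d x y + d y z &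
        forall (x : X) (A : set X),
          nbhs x A <->
          exists2 e : R, 0 < e & [set y | d x y < e] `<=` A].

Definition dynamical_system (R : realType) (X : topologicalType)
    (T : X -> X) : Prop :=
  [/\ compact [set: X], metrizable R X & continuous T].

(* The system [(B, S)] is a factor of [(A, T)], where [A] and [B] carry the
   topologies induced by the ambient spaces [X] and [Y]; only the values of
   [psi] on [A] matter. *)
Definition is_factor (X : topologicalType) (A : set X) (T : X -> X)
    (Y : topologicalType) (B : set Y) (S : Y -> Y) : Prop :=
  exists psi : X -> Y,
    [/\ {within A, continuous psi},
        psi @` A = B &
        forall x, A x -> psi (T x) = S (psi x)].

(** * One-sided subshifts *)

Definition one_sided (Sigma : finType) : Type :=
  {ptws nat -> discrete_topology Sigma}.

HB.instance Definition _ (Sigma : finType) :=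
  Topological.copy (one_sided Sigma) {ptws nat -> discrete_topology Sigma}.

Definition shift (Sigma : finType) (x : one_sided Sigma) : one_sided Sigma :=
  fun i => x i.+1.

Definition is_subshift (Sigma : finType) (Y : set (one_sided Sigma)) : Prop :=
  closed Y /\ (@shift Sigma) @` Y `<=` Y.

Definition is_sft (Gamma : finType) (Z : set (one_sided Gamma)) : Prop :=
  exists forbidden : seq (seq Gamma),
    Z = [set x | forall (w : seq Gamma) (i : nat), w \in forbidden ->
                   mkseq (fun j => (x (i + j)%N : Gamma)) (size w) <> w].

Definition is_sofic (Sigma : finType) (Y : set (one_sided Sigma)) : Prop :=
  exists (Gamma : finType) (Z : set (one_sided Gamma)),
    is_sft Z /\ is_factor Z (@shift Gamma) Y (@shift Sigma).

Definition regular_system (R : realType) (X : topologicalType)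
    (T : X -> X) : Prop :=
  [/\ dynamical_system R T,
      zero_dimensional X &
      forall (Sigma : finType) (Y : set (one_sided Sigma)),
        is_subshift Y -> is_factor [set: X] T Y (@shift Sigma) -> is_sofic Y].

(** * Multiplication automata *)

Definition config (N : nat) : Type :=
  {ptws int -> discrete_topology 'I_N}.

HB.instance Definition _ (N : nat) :=
  Topological.copy (config N) {ptws int -> discrete_topology 'I_N}.

(* With [q = N / p], the digits [a = a1 q + a0] and [b = b1 q + b0]
   are sent to [a0 p + b1]. *)
Definition mul_rule (N p a b : nat) : nat :=
  let q := (N %/ p)%N in ((a %% q) * p + b %/ q)%N.

Lemma mul_rule_lt (N p : nat) (pN : (p %| N)%N) (a b : 'I_N) :
  (mul_rule N p a b < N)%N.
Proof.
have N0 : (0 < N)%N by case: a => a /=; exact: leq_ltn_trans.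
have p0 : (0 < p)%N by exact: dvdn_gt0 pN.
have q0 : (0 < N %/ p)%N by rewrite divn_gt0// dvdn_leq.
have eN := divnK pN; rewrite /mul_rule.
set q := (N %/ p)%N in q0 eN *.
have b1 : (b %/ q < p)%N by rewrite ltn_divLR// mulnC eN.
rewrite -[X in (_ < X)%N]eN.
apply: (@leq_trans ((a %% q).+1 * p)%N); last by rewrite leq_mul2r ltn_mod q0 orbT.
by rewrite mulSn addnC ltn_add2r.
Qed.

Definition mul_aut (N p : nat) (pN : (p %| N)%N) (x : config N) : config N :=
  fun i => Ordinal (mul_rule_lt pN (x i) (x (i + 1))).

(* [is_mul_aut alpha F]: [alpha] is a quotient of products of divisors of [N]
   and [F] is the corresponding composition of the maps [mul_aut] and their
   two-sided inverses. *)
Inductive is_mul_aut (N : nat) : rat -> (config N -> config N) -> Prop :=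
| MulAutId : is_mul_aut 1 id
| MulAutMul (p : nat) (pN : (p %| N)%N) (alpha : rat) (F : config N -> config N) :
    is_mul_aut alpha F -> is_mul_aut (alpha * p%:R) (mul_aut pN \o F)
| MulAutDiv (p : nat) (pN : (p %| N)%N) (G : config N -> config N)
    (alpha : rat) (F : config N -> config N) :
    cancel (mul_aut pN) G -> cancel G (mul_aut pN) ->
    is_mul_aut alpha F -> is_mul_aut (alpha / p%:R) (G \o F).

(* Main.v *)
(* Let [digits v] be the configuration whose [i]-th entry is
   floor(v N^i) mod N.  The automaton Pi_{p,N} sends [digits v] to
   [digits (p v)] for every rational [v], hence any composition [F] of such maps
   and their inverses multiplies [v] by its parameter; configurations [digits v]
   are dense.  On a finite window [digits v] is determined by an integer
   floor(v s) modulo a power of [N], and a sequence of windows is the trace of an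
   orbit of the multiplication by [p] as soon as each pair of successive windows
   is the pair of windows of some [v] and [p v]: given an orbit u, p u, ..., p^n u
   ending in the same window as [v], replacing the fractional part of p^n u s by
   that of v s changes no floor(p^t u s) with t <= n.  Hence the window traces of
   Pi_{p,N} form an edge shift, those of its inverse form the reversed edge shift,
   and by compactness every subshift factor is a one-block image of such a
   trace. *)
Require Import Defs.
From mathcomp Require Import all_boot all_order all_algebra.
From mathcomp Require Import ring zify.
From mathcomp Require Import all_classical all_reals topology.
Set Implicit Arguments.
Unset Strict Implicit.
Unset Printing Implicit Defensive.
Import Order.TTheory GRing.Theory Num.Theory.
Local Open Scope classical_set_scope.
Local Open Scope ring_scope.

(** * Topology of configurations: cylinders, compactness, metrizability *)

Lemma nbhs_ptws_discrete (I T : choiceType)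
    (x : {ptws I -> discrete_topology T}) (A : set {ptws I -> discrete_topology T}) :
  nbhs x A <->
  exists s : seq I, [set y | {in s, forall i, y i = x i}] `<=` A.
Proof.
have Fx : Filter (nbhs x) by exact: nbhs_filter.
split=> [|[s sA]]; last first.
  apply: (filterS sA); elim: s {sA} => [|i s IHs].
    by apply: (@filterS _ (nbhs x) _ setT); [move=> y _ i|exact: filterT].
  have xi : nbhs x [set y | y i = x i].
    have cpr := @proj_continuous I (fun=> discrete_topology T) i x.
    exact: (cpr [set x i] (discrete_set1 (x i : discrete_topology T))).
  apply: (filterS _ (filterI xi IHs)) => y [/= yi ys] j.
  by rewrite in_cons => /orP[/eqP ->|/ys].
pose F : set_system {ptws I -> discrete_topology T} := [set B |
  exists s : seq I, [set y | {in s, forall i, y i = x i}] `<=` B].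
have FF : Filter F.
  split=> [|B C [s sB] [r rC]|B C BC [s sB]].
  - by exists [::].
  - exists (s ++ r) => y ysr; split; [apply: sB|apply: rC] => i Hi;
      by apply: ysr; rewrite mem_cat Hi ?orbT.
  - by exists s; exact: subset_trans BC.
(* The cylinder filter converges to [x] in each coordinate, hence in the product topology, so it
   contains every neighbourhood of [x]. *)
suff Fcv : F --> x by move=> xA; exact: Fcv.
apply/cvg_sup => i U [V] [[W] oW <-] /= Wx VU.
exists [:: i] => y yx; apply: VU => /=.
by rewrite yx// mem_head.
Qed.

Lemma ptws_finite_compact (I : choiceType) (T : finType) :
  compact [set: {ptws I -> discrete_topology T}].
Proof.
have fT : compact [set: discrete_topology T] by exact/finite_compact/finite_finset.
have := tychonoff (fun _ : I => fT).
by congr (compact _); rewrite eqEsubset.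
Qed.

Section ConfigTopology.
Context {N : nat}.
Implicit Types x y z : config N.

Definition agree (n : nat) x y := forall i : int, (`|i| < n)%N -> x i = y i.

Lemma agree_sym n x y : agree n x y -> agree n y x.
Proof. by move=> xy i /xy. Qed.

Lemma agree_trans n x y z : agree n x y -> agree n y z -> agree n x z.
Proof. by move=> xy yz i ni; rewrite xy ?yz. Qed.

Lemma agree_le m n x y : (m <= n)%N -> agree n x y -> agree m x y.
Proof. by move=> mn xy i im; apply: xy; exact: leq_trans mn. Qed.

Lemma nbhs_config x (A : set (config N)) :
  nbhs x A <-> exists n, [set y | agree n x y] `<=` A.
Proof.
have H := @nbhs_ptws_discrete int 'I_N x A.
split=> [/H[s sA]|[n nA]].
  exists (\max_(i <- s) `|i|.+1)%N => y xy; apply: sA => i si.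
  by apply/esym/xy; exact: (@leq_bigmax_seq _ s xpredT (fun i : int => `|i|.+1)).
apply/H; exists ([seq Posz k | k <- iota 0 n] ++ [seq - Posz k | k <- iota 0 n]).
move=> y ys; apply: nA => i ni; apply/esym/ys; rewrite mem_cat.
case: (intP i) ni => [|k|k]; rewrite ?abszN => ni; apply/orP.
- by left; apply/mapP; exists 0%N; rewrite ?mem_iota.
- by left; apply/mapP; exists k.+1; rewrite ?mem_iota.
- by right; apply/mapP; exists k.+1; rewrite ?mem_iota.
Qed.

Lemma config_cluster (u : nat -> config N) :
  exists x, forall n m, exists2 k, (m <= k)%N & agree n x (u k).
Proof.
have := @ptws_finite_compact int 'I_N.
move=> /(_ (u @ \oo) _ filterT)[x [_ ux]]; exists x => n m.
have ne : (u @ \oo) [set u k | k in [set k | (m <= k)%N]].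
  by exists m => // k /= mk; exists k.
have nx : nbhs (x : config N) [set y | agree n x y] by apply/nbhs_config; exists n.
have [_ [[k /= mk <-] xk]] := ux _ _ ne nx.
by exists k.
Qed.

Lemma config_zero_dimensional : zero_dimensional (config N).
Proof.
exact: (@zero_dimension_prod int (fun=> discrete_topology 'I_N)
  (fun=> discrete_zero_dimension)).
Qed.

Lemma agree_all x y : (forall n, agree n x y) -> x = y.
Proof. by move=> xy; apply/funext => i; exact: (xy `|i|.+1). Qed.

Lemma config_metrizable (R : realType) : metrizable R (config N).
Proof.
pose disagree x y n := `[< ~ agree n.+1 x y >].
have disP x y : x <> y -> exists n, disagree x y n.
  move=> nxy; apply: contrapT => nD; apply: nxy; apply: agree_all => -[|n].
    by move=> i.
  by apply: contrapT => nA; apply: nD; exists n; exact/asboolP.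
(* The distance is [1/(n+1)], with [n] the least absolute value of a position where [x] and [y]
   differ. *)
pose d x y : R := if pselect (x = y) is right nxy
  then (ex_minn (disP _ _ nxy)).+1%:R^-1 else 0.
have d0 x y : 0 <= d x y by rewrite /d; case: pselect => *; rewrite ?invr_ge0.
have dP x y n : d x y < n.+1%:R^-1 <-> agree n.+1 x y.
  rewrite /d; case: pselect => [<-|nxy].
    by split => // _; rewrite invr_gt0.
  case: ex_minnP => m /asboolP mP mmin; rewrite ltf_pV2 ?posrE// ltr_nat ltnS.
  split=> [nm|A].
    by apply: contrapT => /asboolP /mmin; rewrite leqNgt nm.
  by rewrite ltnNge; apply/negP => mn; apply: mP; exact: agree_le A.
have dle x y e : 0 <= e -> (forall n, e < n.+1%:R^-1 -> agree n.+1 x y) -> d x y <= e.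
  move=> e0 H; rewrite leNgt; apply/negP.
  have := dP x y; rewrite /d; case: pselect => [_|nxy]; first by rewrite ltNge e0.
  by case: ex_minnP => m /asboolP mP _ _ /H.
exists d; split=> //.
- move=> x y; split=> [dxy|->]; last by rewrite /d; case: pselect.
  apply: agree_all => -[|n]; first by move=> i.
  by apply/dP; rewrite dxy invr_gt0 ltr0n.
- move=> x y; apply/le_anti/andP; split; apply: dle => // n /dP; exact: agree_sym.
- move=> x y z; apply: dle => [|n]; first by rewrite addr_ge0.
  move=> H; apply: (@agree_trans _ _ y); apply/dP; apply: le_lt_trans H.
    by rewrite lerDl.
  by rewrite lerDr.
- move=> x A; rewrite nbhs_config; split=> [[n nA]|[e e0 eA]].
    exists n.+1%:R^-1; first by rewrite invr_gt0 ltr0n.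
    by move=> y /= /dP xy; apply: nA; exact: agree_le xy.
  have [n ne] := ltr_add_invr (y := 0) (x := e) e0.
  exists n.+1 => y /dP xy; apply: eA => /=; apply: lt_trans xy _.
  by rewrite add0r in ne.
Qed.

Definition uniform_agree (F : config N -> config N) :=
  forall m, exists k, forall x y, agree k x y -> agree m (F x) (F y).

Lemma uniform_agree_iter F t : uniform_agree F -> uniform_agree (iter t F).
Proof.
move=> uF; elim: t => [|t IH] m; first by exists m.
have [k kP] := uF m; have [l lP] := IH k.
by exists l => x y /lP /kP.
Qed.

End ConfigTopology.

(** * Base-[N] digits of rationals *)

Local Notation floor := Num.floor.

Lemma floor_div_nat (R : archiRealFieldType) (x : R) (n : nat) :
  (0 < n)%N -> floor (x / n%:R) = (floor x %/ n%:Z)%Z.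
Proof.
move=> n0; have n0R : 0 < n%:R :> R by rewrite ltr0n.
have n0Z : 0 < n%:Z by [].
apply/eqP; rewrite floor_eq ler_pdivlMr// ltr_pdivrMr//.
have -> : n%:R = n%:Z%:~R :> R by [].
rewrite -!intrM -floor_ge_int -floor_lt_int lez_floor ?gt_eqF//.
by rewrite ltz_ceil.
Qed.

Lemma expfzS (F : fieldType) (x : F) (i : int) :
  x != 0 -> x ^ (i + 1) = x ^ i * x.
Proof. by move=> x0; rewrite expfzDr// expr1z. Qed.

Lemma modzMA (A : int) (d e : nat) : (0 < d)%N -> (0 < e)%N ->
  (A %% (d * e)%N%:Z)%Z = ((A %/ d%:Z)%Z %% e%:Z)%Z * d%:Z + (A %% d%:Z)%Z.
Proof.
move=> d0 e0; rewrite PoszM mulrC {1}(divz_eq A d%:Z).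
rewrite {1}(divz_eq (A %/ d%:Z)%Z e%:Z) mulrDl -mulrA -addrA modzMDl.
set a := (_ %% e%:Z)%Z; set b := (A %% _)%Z.
have a0 : 0 <= a by rewrite modz_ge0// gt_eqF.
have ae : a + 1 <= e%:Z by rewrite lezD1 ltz_pmod.
have b0 : 0 <= b by rewrite modz_ge0// gt_eqF.
have bd : b < d%:Z by rewrite ltz_pmod.
rewrite modz_small// addr_ge0 ?mulr_ge0//=.
apply: (@lt_le_trans _ _ ((a + 1) * d%:Z)); first by rewrite [ltRHS]mulrDl mul1r ltrD2l.
by rewrite ler_wpM2r.
Qed.

Lemma eq_mod_digits (N L : nat) (A B : int) : (0 < N)%N ->
  (A = B %[mod (N ^ L)%N%:Z])%Z <->
  forall k, (k < L)%N ->
    ((A %/ (N ^ k)%N%:Z)%Z = (B %/ (N ^ k)%N%:Z)%Z %[mod N%:Z])%Z.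
Proof.
move=> N0; have X0 k : (0 < N ^ k)%N by rewrite expn_gt0 N0.
elim: L => [|L IH]; first by split=> // _; rewrite expn0 !modz1.
have XL : (N ^ L)%N%:Z != 0 by rewrite gt_eqF// ltz_nat.
rewrite expnSr !modzMA//; split=> [E k|H].
  have small C : 0 <= (C %% (N ^ L)%N%:Z)%Z < `|(N ^ L)%N%:Z|.
    by rewrite modz_ge0 ?ltz_mod.
  have EL : (A = B %[mod (N ^ L)%N%:Z])%Z.
    by move/(congr1 (modz^~ (N ^ L)%N%:Z)): E; rewrite !modzMDl !modz_mod.
  rewrite ltnS leq_eqVlt => /orP[/eqP ->|]; last exact: IH.1 EL k.
  move/(congr1 (divz^~ (N ^ L)%N%:Z)): E.
  by rewrite !divzMDl// ![((_ %% (N ^ L)%N%:Z)%Z %/ _)%Z]divz_small ?addr0.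
rewrite H//; congr (_ + _); apply/IH => k kL; apply: H; exact: ltnW.
Qed.

Lemma exists_digits (N L : nat) (d : nat -> nat) : (forall k, d k < N)%N ->
  exists A : int, forall k, (k < L)%N ->
    ((A %/ (N ^ k)%N%:Z)%Z %% N%:Z)%Z = d k.
Proof.
move=> dN; have N0 : (0 < N)%N by exact: leq_ltn_trans (dN 0).
elim: L d dN => [|L IH] d dN; first by exists 0.
have [A AP] := IH (fun k => d k.+1) (fun k => dN k.+1).
have d0N : 0 <= (d 0)%:Z < N%:Z by rewrite /= ltz_nat.
exists (A * N%:Z + d 0) => -[_|k]; first by rewrite expn0 divz1 modzMDl modz_small.
rewrite ltnS => kL; rewrite expnS PoszM divzMA_ge0// divzMDl ?gt_eqF//.
by rewrite [X in A + X]divz_small ?addr0 ?AP.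
Qed.

(* [u'] is [u] with the fractional part at time [n] replaced by that of [v]. *)
Lemma orbit_glue (p : nat) (M : int) (s u v : rat) (n : nat) :
  (0 < p)%N -> s != 0 ->
  (floor (u * p%:R ^+ n * s) = floor (v * s) %[mod M])%Z ->
  exists2 u', forall t, (t <= n)%N ->
      floor (u' * p%:R ^+ t * s) = floor (u * p%:R ^+ t * s) &
    (floor (u' * p%:R ^+ n.+1 * s) = floor (v * p%:R * s) %[mod M])%Z.
Proof.
move=> p0 s0 UV; have pn0 k : p%:R ^+ k != 0 :> rat.
  by rewrite expf_neq0// pnatr_eq0 -lt0n.
set U := u * _ * s in UV; set V := v * s in UV.
(* [W] has the integer part of [U] and the fractional part of [V]; the new orbit is the one that
   passes through [W] at time [n]. *)
pose W := V + (floor U - floor V)%:~R.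
have fW : floor W = floor U.
  by rewrite floorDrz ?rpred_int// intrKfloor addrC subrK.
(* Going back from time [n] to [t] divides by a natural number, and the floor of such a quotient
   depends only on the floor of the numerator. *)
have time w t : (t <= n)%N -> w / (p%:R ^+ n * s) * p%:R ^+ t * s = w / (p ^ (n - t))%:R.
  move=> tn; rewrite natrX -{1}(subnK tn) exprD; field.
  by rewrite s0 !pn0.
have UE : u = U / (p%:R ^+ n * s) by rewrite /U; field; rewrite s0 pn0.
exists (W / (p%:R ^+ n * s)) => [t tn|].
  by rewrite UE !time// !floor_div_nat ?expn_gt0 ?p0// fW.
have -> : W / (p%:R ^+ n * s) * p%:R ^+ n.+1 * s =
    v * p%:R * s + (p%:Z * (floor U - floor V))%:~R.
  rewrite exprS intrM /W /V; field; by rewrite s0 pn0.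
rewrite floorDrz ?rpred_int// intrKfloor.
move/eqP: UV; rewrite eqz_mod_dvd => /dvdzP[c ->].
by rewrite mulrA addrC modzMDl.
Qed.

(** * Multiplication automata acting on digit configurations *)

Section Digits.
Context (b : nat).
Local Notation N := b.+1.

(* The digit at position [i] has weight [N ^ - i], and higher positions are
   less significant. *)
Definition digits (v : rat) : config N := fun i =>
  inord `|(floor (v * N%:R ^ i) %% N%:Z)%Z|%N.

Lemma digitsE v i : (digits v i)%:Z = (floor (v * N%:R ^ i) %% N%:Z)%Z.
Proof.
have h : (0 <= floor (v * N%:R ^ i) %% N%:Z)%Z by exact: modz_ge0.
rewrite /digits inordK ?gez0_abs// -ltz_nat gez0_abs//; exact: ltz_pmod.
Qed.

(** Both input digits are read off [A = floor (v N^(i+1))]. Since [p N^i = N^(i+1) / q], the output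
    digit is [A %/ q] modulo [N], which the local rule computes. *)
Lemma mul_aut_digits p (pN : (p %| N)%N) v : mul_aut pN (digits v) = digits (v * p%:R).
Proof.
apply/funext => i; apply/val_inj/eqP; rewrite -eqz_nat; apply/eqP.
rewrite /= /mul_rule.
have p0 : (0 < p)%N by exact: dvdn_gt0 pN.
have q0 : (0 < N %/ p)%N by rewrite divn_gt0// dvdn_leq.
have eN := divnK pN; move: q0 eN; set q := (N %/ p)%N => q0 eN.
rewrite digitsE PoszD PoszM -modz_nat -divz_nat (digitsE v i) (digitsE v (i + 1)).
have N0 : N%:R != 0 :> rat by rewrite pnatr_eq0.
set w := v * N%:R ^ i.
have -> : v * p%:R * N%:R ^ i = v * N%:R ^ (i + 1) / q%:R.
  rewrite expfzS// -eN natrM; field.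
  by rewrite pnatr_eq0 -lt0n.
have wE : floor w = (floor (v * N%:R ^ (i + 1)) %/ N%:Z)%Z.
  by rewrite -floor_div_nat// expfzS// mulrA mulfK.
rewrite floor_div_nat// wE; set A := floor _.
set a := (A %/ N%:Z)%Z; set r := (A %% N%:Z)%Z.
have NqpZ : N%:Z = p%:Z * q%:Z by rewrite -PoszM mulnC eN.
have -> : ((a %% N%:Z)%Z %% q%:Z)%Z = (a %% q%:Z)%Z.
  by rewrite [in RHS](divz_eq a N%:Z) [X in _ * X + _]NqpZ mulrA modzMDl.
have -> : (A %/ q%:Z)%Z = (a %/ q%:Z)%Z * N%:Z +
    ((a %% q%:Z)%Z * p%:Z + (r %/ q%:Z)%Z).
  rewrite {1}(divz_eq A N%:Z) -/a -/r NqpZ mulrA divzMDl ?gt_eqF//.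
  rewrite {1}(divz_eq a q%:Z) -/a; ring.
rewrite modzMDl [RHS]modz_small//; apply/andP; split.
  rewrite addr_ge0 ?mulr_ge0 ?modz_ge0 ?gt_eqF//.
  by rewrite divz_ge0// modz_ge0.
have rq : (r %/ q%:Z)%Z < p%:Z by rewrite ltz_divLR// -NqpZ ltz_pmod.
have aq : (a %% q%:Z)%Z + 1 <= q%:Z by rewrite lezD1 ltz_pmod.
rewrite NqpZ mulrC; apply: (@lt_le_trans _ _ (p%:Z * ((a %% q%:Z)%Z + 1))).
  by rewrite [ltRHS]mulrDr mulr1 mulrC ltrD2l.
by rewrite ler_pM2l.
Qed.

(* Positions [m - 1], ..., [- m], from the least significant one. *)
Definition window (m : nat) (x : config N) : {ffun 'I_(m.*2) -> 'I_N} :=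
  [ffun k : 'I_(m.*2) => x (m%:Z - 1 - k%:Z)].

(** The margin [m.+1] accounts for the leftmost position [- m] of the window. *)
Lemma window_agree m x y : agree m.+1 x y -> window m x = window m y.
Proof. by move=> xy; apply/ffunP => k; rewrite !ffunE xy//; have := ltn_ord k; lia. Qed.

Lemma agree_of_window m x y : window m x = window m y -> agree m x y.
Proof.
move=> xy i im; pose k := absz (m%:Z - 1 - i)%R.
have km : (k < m.*2)%N by rewrite /k; lia.
move/ffunP: xy => /(_ (Ordinal km)); rewrite !ffunE /=.
by have -> : m%:Z - 1 - k%:Z = i by rewrite /k; lia.
Qed.

(** The whole window is read off one integer, whose [k]-th base-[N] digit sits at position
    [m - 1 - k]; windows thus become residues modulo [N ^ m.*2]. *)
Lemma digits_floor m v (k : nat) :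
  (digits v (m%:Z - 1 - k%:Z))%:Z =
  ((floor (v * N%:R ^ (m%:Z - 1)) %/ (N ^ k)%N%:Z)%Z %% N%:Z)%Z.
Proof.
rewrite digitsE -floor_div_nat ?expn_gt0//; congr ((floor _ %% _)%Z).
by rewrite expfzDr ?pnatr_eq0// -exprnN natrX mulrA.
Qed.

Lemma window_digitsP m u v :
  window m (digits u) = window m (digits v) <->
  (floor (u * N%:R ^ (m%:Z - 1)) = floor (v * N%:R ^ (m%:Z - 1))
     %[mod (N ^ m.*2)%N%:Z])%Z.
Proof.
rewrite eq_mod_digits//; split=> [/ffunP uv k km|uv].
  move: (uv (Ordinal km)); rewrite !ffunE => /(congr1 (fun j : 'I_N => j%:Z)).
  by rewrite !digits_floor.
apply/ffunP => k; rewrite !ffunE; apply/val_inj/eqP; rewrite -eqz_nat !digits_floor.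
exact/eqP/uv.
Qed.

Lemma digits_dense m (x : config N) : exists v, window m (digits v) = window m x.
Proof.
have [A AP] := @exists_digits N m.*2 (fun k => x (m%:Z - 1 - k%:Z)) (fun k => ltn_ord _).
have s0 : N%:R ^ (m%:Z - 1) != 0 :> rat by rewrite expfz_neq0// pnatr_eq0.
exists (A%:~R / N%:R ^ (m%:Z - 1)); apply/ffunP => k; rewrite !ffunE.
apply/val_inj/eqP; rewrite -eqz_nat digits_floor divfK// intrKfloor; apply/eqP.
exact: AP.
Qed.

(** Induction on [n]: [orbit_glue] keeps the windows realized so far and makes the next one that of
    [v * p]. *)
Lemma digits_orbit m p n (z : nat -> {ffun 'I_(m.*2) -> 'I_N}) : (0 < p)%N ->
  (forall t, (t <= n)%N -> exists2 v,
     z t = window m (digits v) & z t.+1 = window m (digits (v * p%:R))) ->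
  exists u, forall t, (t <= n.+1)%N -> window m (digits (u * p%:R ^+ t)) = z t.
Proof.
move=> p0; elim: n => [|n IH] zP.
  have [v z0 z1] := zP 0%N isT; exists v => -[_|[_|//]]; by rewrite ?expr0 ?mulr1.
have [u uP] := IH (fun t tn => zP t (leqW tn)).
have [v zv zv'] := zP n.+1 (leqnn _).
have s0 : N%:R ^ (m%:Z - 1) != 0 :> rat by rewrite expfz_neq0// pnatr_eq0.
have /window_digitsP uv : window m (digits (u * p%:R ^+ n.+1)) = window m (digits v).
  by rewrite uP.
have [u' u'u u'v] := orbit_glue p0 s0 uv.
exists u' => t; rewrite leq_eqVlt => /orP[/eqP ->|].
  by rewrite zv'; exact/window_digitsP.
rewrite ltnS => tn; rewrite -uP//; apply/window_digitsP; by rewrite u'u.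
Qed.

(** Multiplying by [p] and then by [N / p] multiplies by [N], which shifts the digits. Hence the
    inverse of [mul_aut pN] is a cellular automaton too. *)
Lemma mul_aut_cofactor p (pN : (p %| N)%N) (qN : (N %/ p %| N)%N) x i :
  mul_aut qN (mul_aut pN x) i = x (i + 1).
Proof.
have p0 : (0 < p)%N by exact: dvdn_gt0 pN.
have q0 : (0 < N %/ p)%N by rewrite divn_gt0// dvdn_leq.
have Nq : (N %/ (N %/ p))%N = p by rewrite divnA// mulKn.
apply/val_inj => /=; rewrite /mul_rule Nq.
set q := (N %/ p)%N in q0 qN *.
have hi_digit y : (x y %/ q < p)%N by rewrite ltn_divLR// mulnC divnK.
by rewrite modnMDl modn_small// divnMDl// (divn_small (hi_digit _)) addn0 -divn_eq.
Qed.

Lemma mul_aut_agree p (pN : (p %| N)%N) m x y :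
  agree m.+1 x y -> agree m (mul_aut pN x) (mul_aut pN y).
Proof. by move=> xy i im; apply/val_inj => /=; rewrite !xy//; lia. Qed.

Lemma mul_aut_inv_agree p (pN : (p %| N)%N) G m x y : cancel G (mul_aut pN) ->
  agree m.+2 x y -> agree m (G x) (G y).
Proof.
move=> GK xy i im; have qN : (N %/ p %| N)%N by rewrite dvdn_div.
(* The value of [G x] at [i] is that of [mul_aut qN x] at [i - 1]; the shift and the neighbour each
   cost one unit of radius. *)
rewrite -(subrK 1 i) -!(mul_aut_cofactor pN qN) !GK.
by apply: (mul_aut_agree qN xy); lia.
Qed.

Lemma is_mul_autP alpha F : is_mul_aut alpha F ->
  uniform_agree F /\ forall v, F (digits v) = digits (v * alpha).
Proof.
elim=> [|p pN a {}F _ [uF Fd]|p pN G a {}F KG GK _ [uF Fd]].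
- by split=> [m|v]; [exists m|rewrite mulr1].
- split=> [m|v]; last by rewrite /= Fd mul_aut_digits mulrA.
  by have [k kP] := uF m.+1; exists k => x y /kP; exact: mul_aut_agree.
- split=> [m|v]; last first.
    have p0 : p%:R != 0 :> rat by rewrite pnatr_eq0 -lt0n (dvdn_gt0 _ pN).
    rewrite /= Fd -[X in G (digits X)](divfK p0) -mul_aut_digits KG.
    by rewrite mulrA.
  by have [k kP] := uF m.+2; exists k => x y /kP; apply: (mul_aut_inv_agree GK).
Qed.

End Digits.

(** * Markov traces *)

Lemma uniform_agree_continuous N (F : config N -> config N) :
  uniform_agree F -> continuous F.
Proof.
move=> uF x A /nbhs_config[m mA]; have [k kP] := uF m.
by apply/nbhs_config; exists k => y /kP; exact: mA.
Qed.

Lemma ptws_map_continuous (Gamma Sigma : finType) (phi : Gamma -> Sigma) :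
  continuous (fun (z : one_sided Gamma) => (fun t => phi (z t)) : one_sided Sigma).
Proof.
move=> z A /(@nbhs_ptws_discrete nat Sigma)[s sA].
apply/(@nbhs_ptws_discrete nat Gamma); exists s => y yz; apply: sA => t ts /=.
by rewrite yz.
Qed.

Lemma is_sft_edge (Gamma : finType) (R : Gamma -> Gamma -> Prop) :
  is_sft [set z : one_sided Gamma | forall t, R (z t) (z t.+1)].
Proof.
exists [seq [:: e.1; e.2] | e <- enum {: Gamma * Gamma} & `[< ~ R e.1 e.2 >]].
apply/seteqP; split=> z /= zP.
  move=> w t /mapP[[a b]]; rewrite mem_filter => /andP[/asboolP /= nR _] ->.
  by move=> [za zb]; apply: nR; rewrite -za -zb addn0 addn1.
move=> t; apply: contrapT => nR.
apply: (zP [:: z t; z t.+1] t); last by rewrite /mkseq /= addn0 addn1.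
apply/mapP; exists (z t, z t.+1) => //; rewrite mem_filter mem_enum andbT.
exact/asboolP.
Qed.

Section Regular.
Context (b : nat).
Local Notation N := b.+1.
Implicit Types (F : config N -> config N).

Lemma window_surj m (w : {ffun 'I_(m.*2) -> 'I_N}) : exists x : config N, window m x = w.
Proof.
exists (fun i : int => if insub (absz (m%:Z - 1 - i)%R) is Some k then w k else ord0).
apply/ffunP => k; rewrite ffunE.
have -> : absz (m%:Z - 1 - (m%:Z - 1 - k%:Z))%R = k by lia.
by rewrite valK.
Qed.

(** By compactness, counterexamples for every [m] would cluster at some [x]; for large [m] both
    members of a pair lie where [f] equals [f x]. *)
Lemma locally_constant_window (T : Type) (f : config N -> T) :
  (forall x, nbhs x [set y | f y = f x]) ->
  exists m, forall x y, window m x = window m y -> f x = f y.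
Proof.
move=> fP; apply: contrapT => /forallNP nf.
have {}nf m : exists xy : config N * config N,
    window m xy.1 = window m xy.2 /\ f xy.1 <> f xy.2.
  apply: contrapT => /forallNP H; apply: (nf m) => x y xy.
  by apply: contrapT => fxy; apply: (H (x, y)).
have [u uP] := choice nf.
have [x xP] := config_cluster (fun m => (u m).1).
have /nbhs_config[n nP] := fP x.
have [m nm xm] := xP n n; have [ww ff] := uP m; apply: ff.
rewrite (nP _ xm) (nP (u m).2)//.
apply: (agree_trans xm); apply: (agree_le nm); exact: agree_of_window.
Qed.

(** The window traces of [F] are the paths of the graph [R]. Only finite paths are required to be
    realized; compactness handles infinite ones. *)
Definition markov_traces F :=
  forall m, exists R : {ffun 'I_(m.*2) -> 'I_N} -> {ffun 'I_(m.*2) -> 'I_N} -> Prop,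
    (forall x, R (window m x) (window m (F x))) /\
    (forall z : nat -> {ffun 'I_(m.*2) -> 'I_N}, (forall t, R (z t) (z t.+1)) ->
       forall n, exists x, forall t, (t <= n)%N -> window m (iter t F x) = z t).

Lemma markov_traces_orbit F m (z : nat -> {ffun 'I_(m.*2) -> 'I_N}) :
  uniform_agree F ->
  (forall n, exists x, forall t, (t <= n)%N -> window m (iter t F x) = z t) ->
  exists x, forall t, window m (iter t F x) = z t.
Proof.
move=> uF /choice[u uP]; have [x xP] := config_cluster u.
exists x => t; have [k kP] := uniform_agree_iter t uF m.+1.
have [n tn xn] := xP k t; rewrite -(uP n t tn); apply: window_agree; exact: kP.
Qed.

(** The symbol of [psi x] at time 0 depends on one window of [x], and equivariance turns this into a
    one-block map from the edge shift of [R] onto [Y]. *)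
Lemma markov_traces_sofic F (Sigma : finType) (Y : set (one_sided Sigma)) :
  uniform_agree F -> markov_traces F ->
  is_factor [set: config N] F Y (@shift Sigma) -> is_sofic Y.
Proof.
move=> uF MF [psi [psic <- psiF]].
have psi_cont : continuous psi by apply/continuous_subspace_setT.
have [m mP] : exists m, forall x y, window m x = window m y -> psi x 0%N = psi y 0%N.
  apply: locally_constant_window => x; apply: (psi_cont x [set y | y 0%N = psi x 0%N]).
  apply/(@nbhs_ptws_discrete nat Sigma); exists [:: 0%N] => y /=; apply.
  exact: mem_head.
have [R [RF zR]] := MF m.
(* [e] picks a configuration with a given window, so that [psi] can be evaluated on windows. *)
have [e eK] := choice (@window_surj m).
have psi_iter x t : psi x t = psi (iter t F x) 0%N.
  by elim: t x => // t IH x; rewrite iterSr -IH psiF.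
exists {ffun 'I_(m.*2) -> 'I_N}, [set z | forall t, R (z t) (z t.+1)].
split; first exact: is_sft_edge.
exists (fun z t => psi (e (z t)) 0%N); split=> //.
  apply: continuous_subspaceT.
  exact: (@ptws_map_continuous {ffun 'I_(m.*2) -> 'I_N} Sigma (fun w => psi (e w) 0%N)).
apply/seteqP; split=> [_ /= [z zP <-]|_ /= [x _ <-]].
  have [x xz] := markov_traces_orbit uF (zR z zP).
  by exists x => //; apply/funext => t; rewrite [LHS]psi_iter; apply: mP; rewrite xz eK.
exists (fun t => window m (iter t F x)); first by move=> t; exact: RF.
by apply/funext => t; rewrite [RHS]psi_iter; apply: mP; rewrite eK.
Qed.

Lemma markov_traces_regular (R : realType) F :
  uniform_agree F -> markov_traces F -> regular_system R F.
Proof.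
move=> uF MF; split; last by move=> Sigma Y _; exact: markov_traces_sofic.
- split; [exact: (@ptws_finite_compact int 'I_N)|exact: config_metrizable|].
  exact: uniform_agree_continuous.
- exact: config_zero_dimensional.
Qed.

(** This makes every orbit of [F] a path in a graph whose edges are defined through rationals
    only. *)
Lemma digits_graph_dense F m : uniform_agree F -> forall x, exists v,
  window m (digits b v) = window m x /\ window m (F (digits b v)) = window m (F x).
Proof.
move=> uF x; have [k kP] := uF m.+1.
have [v vx] := digits_dense (maxn m.+1 k) x; exists v.
have {}vx := agree_of_window vx; split; apply: window_agree.
  by apply: agree_le vx; rewrite leq_maxl.
by apply/kP/(agree_le _ vx); rewrite leq_maxr.
Qed.

Lemma iter_digits F alpha v t : (forall v, F (digits b v) = digits b (v * alpha)) ->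
  iter t F (digits b v) = digits b (v * alpha ^+ t).
Proof.
by move=> Fd; elim: t => [|t IH]; rewrite ?expr0 ?mulr1//= IH Fd exprSr mulrA.
Qed.

Lemma mul_markov_traces F p : (0 < p)%N -> is_mul_aut (p%:R : rat) F ->
  markov_traces F.
Proof.
move=> p0 /is_mul_autP[uF Fd] m.
exists (fun w w' =>
  exists2 v, w = window m (digits b v) & w' = window m (digits b (v * p%:R))).
split=> [x|z zP n].
  by have [v [<- <-]] := digits_graph_dense m uF x; exists v; rewrite ?Fd.
have [u uP] := @digits_orbit b m p n z p0 (fun t _ => zP t).
by exists (digits b u) => t tn; rewrite (iter_digits _ _ Fd) uP// leqW.
Qed.

(* A finite path read backwards is realized by the end point of an orbit of
   the multiplication by [p]. *)
Lemma div_markov_traces F p : (0 < p)%N -> is_mul_aut ((p%:R : rat)^-1) F ->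
  markov_traces F.
Proof.
move=> p0 /is_mul_autP[uF Fd] m; have pn0 : p%:R != 0 :> rat by rewrite pnatr_eq0 -lt0n.
exists (fun w w' =>
  exists2 v, w' = window m (digits b v) & w = window m (digits b (v * p%:R))).
split=> [x|z zP n].
  have [v [<- <-]] := digits_graph_dense m uF x; exists (v / p%:R); first by rewrite Fd.
  by rewrite divfK.
have [|u uP] := @digits_orbit b m p n (fun t => z (n.+1 - t)%N) p0.
  by move=> t tn; rewrite subSS subSn//; exact: zP.
(* After [t] divisions by [p] this end point is [u * p ^ (n + 1 - t)], whose window in the reversed
   path is [z t]. *)
exists (digits b (u * p%:R ^+ n.+1)) => t tn; rewrite (iter_digits _ _ Fd).
have tn1 : (t <= n.+1)%N by rewrite leqW.
rewrite -[in RHS](subKn tn1) -uP ?leq_subr//.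
by rewrite -mulrA exprVn -expfB_cond ?(negPf pn0) ?add0n.
Qed.

End Regular.

Theorem theorem5p19 (R : realType) (N p : nat) :
  (0 < N)%N -> (0 < p)%N ->
  (forall F : config N -> config N,
     is_mul_aut (p%:R : rat)%R F -> regular_system R F) /\
  (forall F : config N -> config N,
     is_mul_aut ((p%:R : rat)^-1)%R F -> regular_system R F).
Proof.
case: N => // b _ p0; split=> F MF; have [uF _] := is_mul_autP MF.
  by apply: markov_traces_regular => //; exact: mul_markov_traces MF.
by apply: markov_traces_regular => //; exact: div_markov_traces MF.
Qed.
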